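(* Let $X$ be an uncountable Polish group with topology $\tau$ and $1\le\xi<\omega_1$. Then the ranks $\alpha^*_\xi,\beta^*_\xi,\gamma^*_\xi$ are translation invariant: for every Baire class $\xi$ function $f:X\to\mathbb{R}$ and $x_0\in X$, $\rho(f\circ L_{x_0})=\rho(f\circ R_{x_0})=\rho(f)$ for $\rho\in\{\alpha^*_\xi,\beta^*_\xi,\gamma^*_\xi\}$, where $L_{x_0}(x)=x_0\cdot x$ and $R_{x_0}(x)=x\cdot x_0$.
   Context: For a Baire class $\xi$ function $f$, let $T_{f,\xi}$ be the set of Polish topologies $\tau'\supseteq\tau$ on $X$ with $\tau'\subseteq\boldsymbol\Sigma^0_\xi(\tau)$ such that $f$ is Baire class $1$ with respect to $\tau'$. For a rank $\rho$ on Baire class $1$ functions, $\rho^*_\xi(f)=\min_{\tau'\in T_{f,\xi}}\rho_{\tau'}(f)$, where $\rho_{\tau'}$ is $\rho$ computed in topology $\tau'$. Base ranks (in a topology on $X$): derivatives are monotone maps $D$ on closed sets with $D(F)\subseteq F$; iterates $D^{\eta+1}=D\circ D^\eta$, intersections at limits; $\mathrm{rk}(D)$ = least $\eta$ with $D^\eta(X)=\emptyset$. $\alpha(f)=\sup_{p<q\in\mathbb{Q}}\mathrm{rk}(D_{A,B})$, $A=\{f\le p\}$, $B=\{f\ge q\}$, $D_{A,B}(F)=\overline{F\cap A}\cap\overline{F\cap B}$. $\beta(f)=\sup_{\varepsilon>0}\mathrm{rk}(D_{f,\varepsilon})$, $D_{f,\varepsilon}(F)=\{x\in F:\inf_{U\ni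 x\text{ open}}\sup_{x_1,x_2\in U\cap F}|f(x_1)-f(x_2)|\ge\varepsilon\}$. $\gamma(f)=\min\{\sup_{\varepsilon>0}\mathrm{rk}(D_{(f_n),\varepsilon}): f_n\text{ continuous}, f_n\to f\text{ pointwise}\}$, $D_{(f_n),\varepsilon}(F)=\{x\in F:\inf_{U\ni x\text{ open}}\inf_N\sup\{|f_m(y)-f_n(y)|:n,m\ge N,y\in U\cap F\}\ge\varepsilon\}$. *)

(* Defs.v *)
From HB Require Import structures.
From mathcomp Require Import all_boot all_order all_algebra.
From mathcomp Require Import all_classical all_reals all_analysis.
From mathcomp Require wochoice.
Import Order.TTheory GRing.Theory Num.Theory.
Import numFieldNormedType.Exports.

Set Implicit Arguments.
Unset Strict Implicit.
Unset Printing Implicit Defensive.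

Local Open Scope classical_set_scope.
Local Open Scope ring_scope.

(** * Countable ordinals

[omega1] is the set of points with countably many predecessors in a
well-ordering of the (uncountable) set of all subsets of [nat]; this initial
segment is a copy of the least uncountable ordinal
([omega1_min], [omega1_countable_pred], [omega1_uncountable]). *)

Definition wo_rel : rel (set nat) :=
  sval (wochoice.well_ordering_principle (set nat)).

Definition omega1 := {x : set nat | `[< countable [set y | wo_rel y x] >]}.

Lemma wo_relP : wochoice.well_order wo_rel.
Proof. by rewrite /wo_rel; case: wochoice.well_ordering_principle. Qed.

Lemma wo_rel_total : total wo_rel.
Proof.
move=> x y; apply: (@wochoice.wo_chainW _ _ predT) => //.
by move=> A _; exact: wo_relP.
Qed.

Lemma wo_rel_anti : antisymmetric wo_rel.
Proof.
move=> x y; apply: (@wochoice.wo_chain_antisymmetric _ _ predT) => //.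
by move=> A _; exact: wo_relP.
Qed.

Lemma wo_rel_trans : transitive wo_rel.
Proof.
move=> y x z xy yz.
have [m [[mA mlb] _]] := @wo_relP (fun t => [|| t == x, t == y | t == z])
  (ex_intro _ x (introT orP (or_introl (eqxx x)))).
have [mx my mz] : [/\ wo_rel m x, wo_rel m y & wo_rel m z].
  by split; apply: mlb; rewrite unfold_in eqxx ?orbT.
move: mA; rewrite unfold_in => /or3P[] /eqP e; subst m => //.
- by rewrite (@wo_rel_anti x y) ?xy.
- by rewrite (@wo_rel_anti z y) ?yz ?my// andbC; apply/andP; split.
Qed.

Fact omega1_display : Order.disp_t. Proof. exact: Order.Disp. Qed.

HB.instance Definition _ := Choice.on omega1.

Definition omega1_le : rel omega1 := fun x y => wo_rel (val x) (val y).
Definition omega1_lt : rel omega1 := fun x y => (y != x) && omega1_le x y.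

Fact omega1_le_anti : antisymmetric omega1_le.
Proof. by move=> x y /wo_rel_anti/val_inj. Qed.

Fact omega1_le_trans : transitive omega1_le.
Proof. by move=> y x z; exact: wo_rel_trans. Qed.

Fact omega1_le_total : total omega1_le.
Proof. by move=> x y; exact: wo_rel_total. Qed.

HB.instance Definition _ := @Order.isOrder.Build omega1_display omega1
  omega1_le omega1_lt _ _ (fun _ _ => erefl) (fun _ _ => erefl)
  (fun _ _ => erefl) omega1_le_anti omega1_le_trans omega1_le_total.

Lemma omega1_min (P : set omega1) : P !=set0 ->
  exists2 m, P m & forall y, P y -> (m <= y)%O.
Proof.
move=> [x Px]; pose A : {pred set nat} := fun t => `[< exists2 u, P u & val u = t >].
have [|m [[/asboolP[u Pu um] mlb] _]] := @wo_relP A.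
  by exists (val x); apply/asboolP; exists x.
exists u => // y Py; rewrite /Order.le/= /omega1_le um; apply: mlb.
by apply/asboolP; exists y.
Qed.

Lemma omega1_countable_pred (x : omega1) :
  countable [set y : omega1 | (y <= x)%O].
Proof.
have /asboolP xC := valP x; set A := [set y | _].
have := @inj_card_eq _ _ A val (in2W val_inj); rewrite card_eq_le => /andP[_ Aval].
apply: sub_countable xC; apply: card_le_trans Aval _.
by apply: subset_card_le => _ [y yx <-].
Qed.

Lemma set_nat_uncountable : ~ countable [set: set nat].
Proof.
move=> /pcard_leP[f]; pose S := [set n | exists2 A, f A = n & ~ A n].
have Snf : ~ S (f S).
  move=> [A fAS AfS]; apply: (AfS).
  have -> : A = S by apply: (@inj _ _ _ f) => //; rewrite in_setT.
  by exists A => // AfA; apply: AfS; rewrite -fAS.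
by apply: (Snf); exists S.
Qed.

Lemma omega1_uncountable : ~ countable [set: omega1].
Proof.
move=> omega1C; pose U : set (set nat) := val @` [set: omega1].
have UC : countable U by apply: sub_countable omega1C; exact: card_image_le.
have [x Ux] : ~` U !=set0.
  apply/set0P/negP => /eqP; rewrite -[_ = _]/(~` U = set0).
  move=> /(congr1 setC); rewrite setCK setC0 => UT.
  by apply: set_nat_uncountable; rewrite -UT.
pose A : {pred set nat} := fun t => `[< ~ U t >].
have [|m [[/asboolP Um mlb] _]] := @wo_relP A; first by exists x; apply/asboolP.
apply: Um; have mC : countable [set y | wo_rel y m].
  apply: (@sub_countable _ _ _
      (\bigcup_(b in [set: bool]) if b then U else [set m])); last first.
    apply: bigcup_countable => [|[] _]; [exact: countableP|exact: UC|].
    exact: countable1.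
  apply: subset_card_le => y ym; have [Uy|Uy] := pselect (U y).
    by exists true.
  exists false => //=; apply: wo_rel_anti; rewrite ym mlb//.
  exact/asboolP.
by exists (exist _ m (asboolT mC)).
Qed.

Lemma omega1_neq0 : [set: omega1] !=set0.
Proof.
apply/set0P/negP => /eqP omega10; apply: omega1_uncountable.
by rewrite omega10; exact: countable0.
Qed.

Lemma omega1_unbounded (x : omega1) : [set y | (x < y)%O] !=set0.
Proof.
apply: contrapT => xmax; apply: omega1_uncountable.
apply: sub_countable (omega1_countable_pred x); apply: subset_card_le => y _ /=.
by rewrite leNgt; apply/negP => xy; apply: xmax; exists y.
Qed.

Lemma omega1_wf : well_founded (fun x y : omega1 => (x < y)%O).
Proof.
move=> x; apply: contrapT => nx.
have [|m nm mmin] := @omega1_min [set y | ~ Acc (fun x y => (x < y)%O) y].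
  by exists x.
apply: nm; constructor => y ym; apply: contrapT => /mmin.
by rewrite leNgt ym.
Qed.

Definition o0 : omega1 := projT1 (cid2 (omega1_min omega1_neq0)).
Definition osucc (x : omega1) : omega1 :=
  projT1 (cid2 (omega1_min (omega1_unbounded x))).
Definition o1 : omega1 := osucc o0.

Lemma o0_le x : (o0 <= x)%O.
Proof. by rewrite /o0; case: cid2 => m _ /= ->. Qed.

Lemma osucc_leE x y : (osucc x <= y)%O = (x < y)%O.
Proof.
rewrite /osucc; case: cid2 => m /= xm mmin.
by apply/idP/idP => [|/mmin//]; exact: lt_le_trans.
Qed.

(** * Values of ranks

Ordinals at most [omega1]: [None] is [omega1] itself.  It also serves as the
rank of a derivative none of whose countable iterates is empty; in a second
countable space a decreasing transfinite sequence of closed sets is constant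
from some countable stage on, so that no iterate at all is then empty. *)

Definition orank := option omega1.

Fact orank_display : Order.disp_t. Proof. exact: Order.Disp. Qed.

HB.instance Definition _ := Choice.on orank.

Definition orank_le : rel orank := fun a b =>
  match a, b with
  | _, None => true
  | None, Some _ => false
  | Some x, Some y => (x <= y)%O
  end.
Definition orank_lt : rel orank := fun a b => (b != a) && orank_le a b.

Fact orank_le_anti : antisymmetric orank_le.
Proof. by move=> [x|] [y|]//= /le_anti ->. Qed.

Fact orank_le_trans : transitive orank_le.
Proof. by move=> [y|] [x|] [z|]//=; exact: le_trans. Qed.

Fact orank_le_total : total orank_le.
Proof. by move=> [x|] [y|]//=; exact: le_total. Qed.

HB.instance Definition _ := @Order.isOrder.Build orank_display orank
  orank_le orank_lt _ _ (fun _ _ => erefl) (fun _ _ => erefl)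
  (fun _ _ => erefl) orank_le_anti orank_le_trans orank_le_total.

(* The least element of [S], and [omega1] if [S] is empty. *)
Definition omin (S : set orank) : orank := xget None (S `&` lbound S).

Definition osup (S : set orank) : orank := omin (ubound S).

Lemma omin_least (S : set orank) : S !=set0 -> S (omin S) /\ lbound S (omin S).
Proof.
move=> [a Sa]; apply: (@xgetPex _ None (S `&` lbound S)).
have [[x Sx]|SN] := pselect (exists x, S (Some x)).
  have [m Sm mmin] : exists2 m, S (Some m) & forall y, S (Some y) -> (m <= y)%O.
    by apply: (@omega1_min [set y | S (Some y)]); exists x.
  by exists (Some m); split => // -[y /mmin|].
exists a; split => // -[y Sy|_]; first by exfalso; apply: SN; exists y.
by case: a {Sa}.
Qed.

Lemma osup_lub (S : set orank) :
  ubound S (osup S) /\ lbound (ubound S) (osup S).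
Proof. by apply: omin_least; exists None => -[]. Qed.

(** * Derivatives *)

(* At a stage that is not a successor (0 or a limit), take the intersection of
   the previous iterates: the whole space at stage 0. *)
Definition iter_deriv_step (T : Type) (D : set T -> set T) (eta : omega1)
    (prev : forall zeta, (zeta < eta)%O -> set T) : set T :=
  match pselect (exists z : {z | (z < eta)%O}, eta = osucc (sval z)) with
  | left e => D (prev _ (svalP (sval (cid e))))
  | right _ => [set x | forall zeta (lt : (zeta < eta)%O), prev zeta lt x]
  end.

Definition iter_deriv (T : Type) (D : set T -> set T) : omega1 -> set T :=
  Fix omega1_wf (fun=> set T) (@iter_deriv_step T D).

Definition drank (T : Type) (D : set T -> set T) : orank :=
  omin [set Some eta | eta in [set eta | iter_deriv D eta = set0]].

Section iter_deriv_lemmas.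
Variables (T : Type) (D : set T -> set T).

Let iter_derivE eta :
  iter_deriv D eta =
  @iter_deriv_step T D eta (fun zeta _ => iter_deriv D zeta).
Proof.
rewrite /iter_deriv Fix_eq// => {}eta f g fg.
suff -> : f = g by [].
apply: functional_extensionality_dep => zeta.
by apply: functional_extensionality_dep => lt; exact: fg.
Qed.

Lemma osucc_inj : injective osucc.
Proof.
move=> x y xy; apply/eqP; rewrite eq_le !leNgt -!osucc_leE; apply/andP; split.
  by rewrite -xy osucc_leE ltxx.
by rewrite xy osucc_leE ltxx.
Qed.

Lemma iter_derivS eta : iter_deriv D (osucc eta) = D (iter_deriv D eta).
Proof.
rewrite iter_derivE /iter_deriv_step; case: pselect => [e|]; last first.
  have lt : (eta < osucc eta)%O by rewrite -osucc_leE.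
  by case; exists (exist _ eta lt).
by case: cid => /= zeta /osucc_inj <-.
Qed.

Lemma iter_deriv_limit eta : (forall zeta, eta <> osucc zeta) ->
  iter_deriv D eta = \bigcap_(zeta in [set z | (z < eta)%O]) iter_deriv D zeta.
Proof.
move=> etalim; rewrite iter_derivE /iter_deriv_step; by case: pselect => // -[zeta eE]; have := etalim (sval zeta); rewrite -eE.
Qed.

Lemma iter_deriv0 : iter_deriv D o0 = setT.
Proof.
rewrite iter_deriv_limit => [|zeta o0E].
  by rewrite -subTset => x _ zeta /=; rewrite ltNge o0_le.
by have := o0_le zeta; rewrite o0E osucc_leE ltxx.
Qed.

End iter_deriv_lemmas.

(** * Topologies on a fixed set

[retop O] is the set [T] regarded as a topological space with open sets [O]. *)

Record topology (T : Type) := Topology {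
  topo_open :> set (set T) ;
  topo_openT : topo_open setT ;
  topo_openI : setI_closed topo_open ;
  topo_open_bigcup : forall F : set (set T), F `<=` topo_open ->
    topo_open (\bigcup_(A in F) A) }.

Definition retop (T : Type) (O : topology T) : Type := T.

Section retop_instance.
Variables (T : choiceType) (O : topology T).

HB.instance Definition _ := Choice.on (retop O).

Fact retop_bigU (I : Type) (f : I -> set T) :
  (forall i, topo_open O (f i)) -> topo_open O (\bigcup_i f i).
Proof.
move=> Of; have := @topo_open_bigcup _ O (range f).
by rewrite bigcup_image; apply => _ [i _ <-].
Qed.

HB.instance Definition _ := isOpenTopological.Build (retop O)
  (topo_openT O) (@topo_openI _ O) retop_bigU.

Lemma retop_open : (@open (retop O) : set (set T)) = O.
Proof.
apply/seteqP; split => A; rewrite openE /interior /=.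
  move=> Aopen; pose F := [set B : set T | topo_open O B /\ B `<=` A].
  suff -> : A = \bigcup_(B in F) B by apply: topo_open_bigcup => B [].
  apply/seteqP; split => [x /Aopen|x [B [_ BA] /BA]//].
  by rewrite nbhsE/= => -[B [OB Bx] BA]; exists B.
by move=> OA x Ax; exists A; split.
Qed.

End retop_instance.

Section descriptive.
Variable R : realType.

Definition complete_space (M : uniformType) : Prop :=
  forall F : set_system M, ProperFilter F -> cauchy F -> exists l : M, F --> l.

Definition completely_metrizable (T : topologicalType) : Prop :=
  exists (M : metricType R) (h : T -> M) (g : M -> T),
    [/\ complete_space M, cancel h g, cancel g h, continuous h & continuous g].

Definition polish (T : topologicalType) : Prop :=
  (exists2 S : set T, countable S & dense S) /\ completely_metrizable T.

(* [Sigma0 xi] has no element when [xi = o0]. *)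
Inductive Sigma0 (T : topologicalType) : omega1 -> set T -> Prop :=
| Sigma0_open (A : set T) : open A -> Sigma0 o1 A
| Sigma0_bigcup (xi : omega1) (A : nat -> set T) (eta : nat -> omega1) :
    (o1 < xi)%O -> (forall n, (eta n < xi)%O) ->
    (forall n, Sigma0 (eta n) (~` A n)) -> Sigma0 xi (\bigcup_n A n).

Inductive Baire_class (T : topologicalType) : omega1 -> (T -> R) -> Prop :=
| Baire_class_continuous (f : T -> R) : continuous f -> Baire_class o0 f
| Baire_class_lim (xi : omega1) (f : T -> R) (fn : nat -> T -> R)
    (eta : nat -> omega1) :
    (forall n, (eta n < xi)%O) -> (forall n, Baire_class (eta n) (fn n)) ->
    (forall x, fn n x @[n --> \oo] --> f x) -> Baire_class xi f.

Definition alpha_deriv (T : topologicalType) (A B : set T) (F : set T) : set T :=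
  closure (F `&` A) `&` closure (F `&` B).

Definition alpha_rank (T : topologicalType) (f : T -> R) : orank :=
  osup [set r | exists p q : rat, p < q /\
    r = drank (alpha_deriv [set x | f x <= ratr p] [set x | ratr q <= f x])].

Definition beta_deriv (T : topologicalType) (f : T -> R) (e : R) (F : set T) :
    set T :=
  [set x | F x /\ (e%:E <= ereal_inf
    [set ereal_sup [set `|f x1 - f x2|%:E | x1 in U `&` F & x2 in U `&` F]
      | U in [set U | open U /\ U x]])%E].

Definition beta_rank (T : topologicalType) (f : T -> R) : orank :=
  osup [set drank (beta_deriv f e) | e in [set e | 0 < e]].

Definition gamma_deriv (T : topologicalType) (fn : nat -> T -> R) (e : R)
    (F : set T) : set T :=
  [set x | F x /\ (e%:E <= ereal_inf
    [set ereal_inf (range (fun N : nat =>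
        ereal_sup [set z | exists n m y, [/\ (N <= n)%N, (N <= m)%N,
          (U `&` F) y & z = `|fn m y - fn n y|%:E]]))
      | U in [set U | open U /\ U x]])%E].

Definition gamma_rank (T : topologicalType) (f : T -> R) : orank :=
  omin [set osup [set drank (gamma_deriv fn e) | e in [set e | 0 < e]]
    | fn in [set fn : nat -> T -> R | (forall n, continuous (fn n)) /\
              (forall x, fn n x @[n --> \oo] --> f x)]].

(* The set [T_{f,xi}]. *)
Definition refinements (T : topologicalType) (xi : omega1) (f : T -> R) :
    set (topology T) :=
  [set O : topology T | [/\ open `<=` O, polish (retop O), O `<=` Sigma0 xi &
    Baire_class o1 (f : retop O -> R)]].

(* The minimum of [rho] over the topologies in [T_{f,xi}]. *)
Definition star (rho : forall T : topologicalType, (T -> R) -> orank)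
    (T : topologicalType) (xi : omega1) (f : T -> R) : orank :=
  omin [set rho (retop O) f | O in refinements xi f].

Definition alpha_star := star alpha_rank.
Definition beta_star := star beta_rank.
Definition gamma_star := star gamma_rank.

End descriptive.

HB.mixin Record isTopologicalGroup G of Group G & Topological G := {
  mulg_continuous : continuous (fun p : G * G => (p.1 * p.2)%g) ;
  invg_continuous : continuous (fun x : G => (x^-1)%g) }.

#[short(type="topologicalGroupType")]
HB.structure Definition TopologicalGroup :=
  {G of isTopologicalGroup G & Group G & Topological G}.

Definition left_translation (X : topologicalGroupType) (x0 x : X) : X :=
  (x0 * x)%g.
Definition right_translation (X : topologicalGroupType) (x0 x : X) : X :=
  (x * x0)%g.

(* Main.v *)
Require Import Defs.
From mathcomp Require Import all_boot all_order all_algebra.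
From mathcomp Require Import all_classical all_reals all_analysis.

(** A homeomorphism [h] of [X] transports every structure in sight: if [O] is
an admissible refinement for [f], then its preimage under [h] is an admissible
refinement for [f \o h], [h] is a homeomorphism between the two refined spaces,
and all three ranks are invariant under homeomorphisms.  Applying this to [h]
and to its inverse, the two sets of ranks whose minimum is taken coincide.
Translations of a topological group are homeomorphisms. *)

Set Implicit Arguments.
Unset Strict Implicit.
Unset Printing Implicit Defensive.

Import Order.TTheory GRing.Theory Num.Theory.
Import numFieldNormedType.Exports.

Local Open Scope classical_set_scope.
Local Open Scope ring_scope.

(** * Preimages under continuous maps, and ranks of conjugate derivatives *)

Definition homeomorphism (T T' : topologicalType) (h : T -> T') (g : T' -> T) :=
  [/\ cancel h g, cancel g h, continuous h & continuous g].

Lemma homeomorphism_sym (T T' : topologicalType) (h : T -> T') (g : T' -> T) :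
  homeomorphism h g -> homeomorphism g h.
Proof. by case. Qed.

Lemma preimage_cancel (T T' : Type) (h : T -> T') (g : T' -> T) (A : set T) :
  cancel h g -> h @^-1` (g @^-1` A) = A.
Proof. by move=> hK; apply/seteqP; split=> x /=; rewrite hK. Qed.

(** Induction on the construction of [A]: preimages commute with countable unions and with
    complements. *)
Lemma Sigma0_preimage (T T' : topologicalType) (h : T -> T') (xi : omega1)
    (A : set T') :
  continuous h -> Sigma0 xi A -> Sigma0 xi (h @^-1` A).
Proof.
move=> /continuousP hc; elim=> [B oB|{}xi B eta xi1 etaxi _ IH].
  exact/Sigma0_open/hc.
by rewrite preimage_bigcup; apply: (@Sigma0_bigcup _ _ _ eta).
Qed.

Lemma Baire_class_comp (R : realType) (T T' : topologicalType) (h : T -> T')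
    (xi : omega1) (f : T' -> R) :
  continuous h -> Baire_class xi f -> Baire_class xi (f \o h).
Proof.
move=> hc; elim=> [k kc|{}xi k kn eta etaxi _ IH knk].
  by apply: Baire_class_continuous => x; apply: continuous_comp;
    [exact: hc|exact: kc].
apply: (@Baire_class_lim _ _ _ _ (fun n => kn n \o h) eta) => // x.
exact: knk.
Qed.

(** By transfinite induction the iterates of [D] are the preimages of those of [D']. Since [g] makes
    [h] surjective, such a preimage is empty only if the set itself is, so both sequences vanish at
    the same stages. *)
Lemma drank_preimage (T T' : Type) (h : T -> T') (g : T' -> T)
    (D : set T -> set T) (D' : set T' -> set T') :
  cancel g h -> (forall F, D (h @^-1` F) = h @^-1` (D' F)) ->
  drank D = drank D'.
Proof.
move=> gK DD'; have iterE eta : iter_deriv D eta = h @^-1` (iter_deriv D' eta).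
  elim/(well_founded_ind omega1_wf): eta => eta IH.
  (* Stage 0 falls under the second case, as an empty intersection. *)
  have [[z zE]|Nz] := pselect (exists z, eta = osucc z).
    by rewrite zE !iter_derivS IH ?DD'// zE -osucc_leE.
  have etalim z : eta <> osucc z by move=> ?; apply: Nz; exists z.
  rewrite !iter_deriv_limit// preimage_bigcap.
  exact: eq_bigcapr.
rewrite /drank; congr (omin (_ @` _)); apply/seteqP; split=> eta /=.
  rewrite iterE -!subset0 => D0 y Dy; apply: (D0 (g y)).
  by rewrite /preimage/= gK.
by rewrite iterE => ->; rewrite preimage_set0.
Qed.

(** * Homeomorphism invariance of Polishness and of the ranks *)

Section homeomorphism_ranks.
Variables (R : realType) (T T' : topologicalType) (h : T -> T') (g : T' -> T).
Hypothesis hg : homeomorphism h g.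

Let hK : cancel h g. Proof. by case: hg. Qed.
Let gK : cancel g h. Proof. by case: hg. Qed.
Let hc : continuous h. Proof. by case: hg. Qed.
Let gc : continuous g. Proof. by case: hg. Qed.

Lemma polish_homeomorphism : polish R T' -> polish R T.
Proof.
move=> [[S cS dS] [M [k [l [cM kK lK kc lc]]]]]; split.
  exists (g @` S).
    by apply: sub_countable cS; exact: card_image_le.
  move=> U [x Ux] oU; have [||y [Uy Sy]] := dS (g @^-1` U).
  - by exists (h x); rewrite /preimage/= hK.
  - exact/(continuousP g).1.
  by exists (g y); split=> //; exists y.
(* The same complete metric space [M] serves for [T]. *)
exists M, (k \o h), (g \o l); split=> //.
- by move=> x /=; rewrite kK hK.
- by move=> x /=; rewrite gK lK.
- by move=> x; apply: continuous_comp; [exact: hc|exact: kc].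
- by move=> x; apply: continuous_comp; [exact: lc|exact: gc].
Qed.

(** Continuity of [h] gives the inclusion from left to right, continuity of [g] the converse. *)
Lemma closure_preimage_homeomorphism (A : set T') :
  closure (h @^-1` A) = h @^-1` (closure A).
Proof.
apply/seteqP; split=> x clx U.
  move=> /hc/clx [y [Ay Uy]].
  by exists (h y).
move=> Ux; have [|y [Ay Uy]] := clx (g @^-1` U).
  by apply: gc; rewrite hK.
by exists (g y); split=> //; rewrite /preimage/= gK.
Qed.

(** The derivatives behind [beta_rank] and [gamma_rank] both take an infimum over open
    neighbourhoods; [Q] stands for the quantity attached to each, so one change of index serves
    both. *)
Lemma image_open_nbhs_homeomorphism (V : Type) (x : T) (Q : set T -> V) :
  [set Q U | U in [set U | open U /\ U x]] =
  [set Q (h @^-1` U) | U in [set U | open U /\ U (h x)]].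
Proof.
apply/seteqP; split=> _ [U [oU Ux] <-].
  exists (g @^-1` U); last by rewrite preimage_cancel.
  by split; [exact/(continuousP g).1|rewrite /preimage/= hK].
by exists (h @^-1` U) => //; split=> //; exact/(continuousP h).1.
Qed.

Lemma alpha_rank_homeomorphism (f : T' -> R) :
  alpha_rank (f \o h) = alpha_rank f.
Proof.
rewrite /alpha_rank; congr osup; apply/seteqP; split=> _ [p [q [pq ->]]];
  exists p, q; split=> //; [|apply: esym]; apply: (drank_preimage gK) => F;
  by rewrite /alpha_deriv preimage_setI -!closure_preimage_homeomorphism.
Qed.

Lemma beta_rank_homeomorphism (f : T' -> R) :
  beta_rank (f \o h) = beta_rank f.
Proof.
rewrite /beta_rank; congr osup; apply: eq_imagel => e _.
apply: (drank_preimage gK) => F; apply/seteqP.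
(* Both derivatives compare an oscillation with [e], so it suffices that the oscillation of [f \o h]
   at [x] on the preimage of [F] is that of [f] at [h x] on [F]. *)
suff E x : ereal_inf [set ereal_sup
      [set `|(f \o h) x1 - (f \o h) x2|%:E
        | x1 in U `&` h @^-1` F & x2 in U `&` h @^-1` F]
      | U in [set U | open U /\ U x]] =
    ereal_inf [set ereal_sup
      [set `|f x1 - f x2|%:E | x1 in U `&` F & x2 in U `&` F]
      | U in [set U | open U /\ U (h x)]].
  by split=> x [Fx]; rewrite /beta_deriv/= E.
rewrite image_open_nbhs_homeomorphism; congr ereal_inf.
apply: eq_imagel => U _; congr ereal_sup; apply/seteqP; split.
  by move=> _ [a aU [b bU <-]]; exists (h a) => //; exists (h b).
move=> _ [a aU [b bU <-]]; exists (g a); first by rewrite /preimage/= gK.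
by exists (g b); rewrite /preimage/= !gK.
Qed.

(** The sequence is fixed here; the minimum over sequences is treated in [gamma_rank_homeomorphism],
    which needs this both for [h] and for [g]. *)
Lemma drank_gamma_deriv_homeomorphism (fn : nat -> T' -> R) (e : R) :
  drank (gamma_deriv (fun n => fn n \o h) e) = drank (gamma_deriv fn e).
Proof.
apply: (drank_preimage gK) => F; apply/seteqP.
suff E x : ereal_inf [set ereal_inf (range (fun N : nat =>
        ereal_sup [set z | exists n m y, [/\ (N <= n)%N, (N <= m)%N,
          (U `&` h @^-1` F) y & z = `|(fn m \o h) y - (fn n \o h) y|%:E]]))
      | U in [set U | open U /\ U x]] =
    ereal_inf [set ereal_inf (range (fun N : nat =>
        ereal_sup [set z | exists n m y, [/\ (N <= n)%N, (N <= m)%N,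
          (U `&` F) y & z = `|fn m y - fn n y|%:E]]))
      | U in [set U | open U /\ U (h x)]].
  by split=> x [Fx]; rewrite /gamma_deriv/= E.
rewrite image_open_nbhs_homeomorphism; congr ereal_inf.
apply: eq_imagel => U _; congr ereal_inf; apply: eq_imagel => N _.
congr ereal_sup; apply/seteqP; split=> z [n [m [y [Nn Nm Uy ->]]]].
  by exists n, m, (h y).
by exists n, m, (g y); rewrite /preimage/= gK.
Qed.

End homeomorphism_ranks.

Lemma gamma_rank_homeomorphism (R : realType) (T T' : topologicalType)
    (h : T -> T') (g : T' -> T) (hg : homeomorphism h g) (f : T' -> R) :
  gamma_rank (f \o h) = gamma_rank f.
Proof.
have [hK gK hc gc] := hg.
rewrite /gamma_rank; congr omin; apply/seteqP; split=> _ [fn [fnc fnf] <-].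
  (* Composition with [g] turns a sequence converging to [f \o h] into one converging to [f];
     composition with [h] goes back. *)
  exists (fun n => fn n \o g).
    split=> [n x|x]; first by apply: continuous_comp; [exact: gc|exact: fnc].
    by have := fnf (g x); rewrite /= gK.
  congr osup; apply: eq_imagel => e _.
  exact: drank_gamma_deriv_homeomorphism (homeomorphism_sym hg) _ _.
exists (fun n => fn n \o h).
  split=> [n x|x]; first by apply: continuous_comp; [exact: hc|exact: fnc].
  exact: fnf.
congr osup; apply: eq_imagel => e _.
exact: drank_gamma_deriv_homeomorphism hg _ _.
Qed.

(** * Transport of refined topologies *)

Section pullback_topology.
Variables (T T' : Type) (g : T' -> T) (O : topology T').

(** Testing openness by preimages under [g], rather than by images under [h], reduces the axioms to
    the commutation of preimages with unions and intersections. *)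
Let pullback_open : set (set T) := [set A | topo_open O (g @^-1` A)].

Let pullback_openT : pullback_open setT.
Proof. by rewrite /pullback_open/= preimage_setT; exact: topo_openT. Qed.

Let pullback_openI : setI_closed pullback_open.
Proof.
by move=> A B; rewrite /pullback_open/= preimage_setI; exact: topo_openI.
Qed.

Let pullback_open_bigcup (F : set (set T)) : F `<=` pullback_open ->
  pullback_open (\bigcup_(A in F) A).
Proof.
move=> FO; rewrite /pullback_open/= preimage_bigcup.
rewrite -(bigcup_image F (preimage g) id).
by apply: topo_open_bigcup => _ [A /FO OA <-].
Qed.

(* [g] is meant to be the inverse of a bijection [h], and this is then the
   topology of the preimages under [h] of the sets in [O]. *)
Definition pullback_topology : topology T :=
  Topology pullback_openT pullback_openI pullback_open_bigcup.

End pullback_topology.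

Lemma retop_homeomorphism (T T' : choiceType) (h : T -> T') (g : T' -> T)
    (O : topology T') :
  cancel h g -> cancel g h ->
  @homeomorphism (retop (pullback_topology g O)) (retop O) h g.
Proof.
move=> hK gK; split=> //; apply/continuousP => A; rewrite !retop_open//=.
by rewrite /pullback_topology/= preimage_cancel.
Qed.

(** Two levels are used: [h] and [g] between the original topologies give the inclusions in the
    first and third clauses, while Polishness and Baire class 1 pass through the homeomorphism of
    the refined spaces. *)
Lemma refinements_pullback (R : realType) (T T' : topologicalType) (h : T -> T')
    (g : T' -> T) (xi : omega1) (f : T' -> R) (O : topology T') :
  homeomorphism h g -> refinements xi f O ->
  refinements xi (f \o h) (pullback_topology g O).
Proof.
move=> [hK gK hc gc] [openO polO OSigma fO].
have rhg := retop_homeomorphism O hK gK; have [_ _ rhc _] := rhg.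
split.
- by move=> A oA; apply: openO; exact/(continuousP g).1.
- exact: polish_homeomorphism rhg polO.
- by move=> A /OSigma /(Sigma0_preimage hc); rewrite preimage_cancel.
- exact: Baire_class_comp rhc fO.
Qed.

(** Invariance of [rho] is assumed over all spaces because it is applied to the refined spaces, not
    to [T] and [T']. *)
Lemma star_homeomorphism (R : realType)
    (rho : forall T : topologicalType, (T -> R) -> orank) :
  (forall (T T' : topologicalType) (h : T -> T') (g : T' -> T),
    homeomorphism h g -> forall f : T' -> R, rho T (f \o h) = rho T' f) ->
  forall (T T' : topologicalType) (h : T -> T') (g : T' -> T) (xi : omega1)
    (f : T' -> R), homeomorphism h g -> star rho xi (f \o h) = star rho xi f.
Proof.
move=> rho_inv.
have sub (T T' : topologicalType) (h : T -> T') (g : T' -> T) xi (f : T' -> R) :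
    homeomorphism h g ->
    [set rho (retop O) f | O in refinements xi f] `<=`
    [set rho (retop O) (f \o h) | O in refinements xi (f \o h)].
  move=> hg _ [tau ftau <-]; exists (pullback_topology g tau).
    exact: refinements_pullback.
  have [hK gK _ _] := hg.
  exact: (rho_inv _ _ _ _ (retop_homeomorphism tau hK gK) f).
move=> T T' h g xi f hg; rewrite /star; congr omin.
apply/seteqP; split; last exact: sub hg.
(* The converse inclusion is [sub] for [g] and the function [f \o h]. *)
have := sub _ _ g h xi (f \o h) (homeomorphism_sym hg).
suff -> : (f \o h) \o g = f; first exact.
by case: hg => _ gK _ _; apply/funext => x /=; rewrite gK.
Qed.

(** * Translations of a topological group *)

Lemma left_translation_homeomorphism (X : topologicalGroupType) (x0 : X) :
  homeomorphism (left_translation x0) (left_translation (x0^-1)%g).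
Proof.
have cont (y : X) : continuous (left_translation y).
  move=> x; apply: (@continuous_comp _ _ _ (pair y) (fun p => (p.1 * p.2)%g)).
    by apply: cvg_pair; [exact: cvg_cst|exact: cvg_id].
  exact: mulg_continuous.
split; [move=> x|move=> x|exact: cont|exact: cont].
  by rewrite /left_translation mulKg.
by rewrite /left_translation mulVKg.
Qed.

Lemma right_translation_homeomorphism (X : topologicalGroupType) (x0 : X) :
  homeomorphism (right_translation x0) (right_translation (x0^-1)%g).
Proof.
have cont (y : X) : continuous (right_translation y).
  move=> x; apply: (@continuous_comp _ _ _ (pair^~ y) (fun p => (p.1 * p.2)%g)).
    by apply: cvg_pair; [exact: cvg_id|exact: cvg_cst].
  exact: mulg_continuous.
split; [move=> x|move=> x|exact: cont|exact: cont].
  by rewrite /right_translation mulgK.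
by rewrite /right_translation mulgVK.
Qed.

Theorem theorem5p9 (R : realType) (X : topologicalGroupType)
    (hX : polish R X) (hunc : ~ countable [set: X]%classic)
    (xi : omega1) (hxi : (o1 <= xi)%O)
    (f : X -> R) (hf : Baire_class xi f) (x0 : X) :
  [/\ alpha_star xi (f \o left_translation x0) = alpha_star xi f /\
      alpha_star xi (f \o right_translation x0) = alpha_star xi f,
      beta_star xi (f \o left_translation x0) = beta_star xi f /\
      beta_star xi (f \o right_translation x0) = beta_star xi f &
      gamma_star xi (f \o left_translation x0) = gamma_star xi f /\
      gamma_star xi (f \o right_translation x0) = gamma_star xi f].
Proof.
have alpha_inv := star_homeomorphism (@alpha_rank_homeomorphism R).
have beta_inv := star_homeomorphism (@beta_rank_homeomorphism R).
have gamma_inv := star_homeomorphism (@gamma_rank_homeomorphism R).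
have left_homeo := left_translation_homeomorphism x0.
have right_homeo := right_translation_homeomorphism x0.
split; split.
- exact: alpha_inv left_homeo.
- exact: alpha_inv right_homeo.
- exact: beta_inv left_homeo.
- exact: beta_inv right_homeo.
- exact: gamma_inv left_homeo.
- exact: gamma_inv right_homeo.
Qed.
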